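(* Let $p$ be an odd prime and let $\varepsilon$ be an integer which is not a square modulo $p$. For $\tau$ in the upper half plane $\mathcal{H}$ let $E_\tau=\mathbb{C}/\langle \tau,1\rangle$ and let $\phi_\tau$ be the $\mathbb{F}_p$-linear endomorphism of $E_\tau[p]$ whose matrix in the basis $\left\{\frac1p,\frac{\tau}{p}\right\}$ is $\left(\begin{smallmatrix}0&1\\ \varepsilon&0\end{smallmatrix}\right)$. Then the moduli problem of pairs $(E,\phi)$ is represented (on complex points) by the Cartan non-split curve $Y_{ns}^{\varepsilon}(p)=\Gamma_{ns}^{\varepsilon}(p)\backslash\mathcal{H}$: the rule $\Gamma_{ns}^{\varepsilon}(p)\tau\mapsto(E_\tau,\phi_\tau)$ is a well-defined bijection from $Y_{ns}^{\varepsilon}(p)$ onto the set of isomorphism classes of pairs $(E,\phi)$.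
   Context: $\Gamma_{ns}^{\varepsilon}(p)$ is the group of matrices $\left(\begin{smallmatrix}a&b\\c&d\end{smallmatrix}\right)\in \mathrm{SL}_2(\mathbb{Z})$ with $a\equiv d$ and $c\equiv \varepsilon b \pmod p$; it acts on $\mathcal{H}$ by fractional linear transformations. A pair $(E,\phi)$ consists of an elliptic curve $E/\mathbb{C}$ and $\phi\in\mathrm{End}_{\mathbb{F}_p}(E[p])$ such that $\phi^2$ is multiplication by $\varepsilon$. Two pairs $(E,\phi)$ and $(E',\phi')$ are isomorphic if there is an isomorphism of elliptic curves $\Psi:E\to E'$ with $\Psi\circ\phi=\phi'\circ\Psi$ on $E[p]$. Matrices of endomorphisms act on column vectors, so $\phi_\tau(\frac1p)=\frac{\varepsilon\tau}{p}$ and $\phi_\tau(\frac{\tau}{p})=\frac1p$. *)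

(* Defs.v *)
From HB Require Import structures.
From mathcomp Require Import all_boot all_order all_algebra.
From mathcomp Require Import all_classical all_reals all_analysis.
From mathcomp Require Import complex.
From mathcomp Require Import ring.

Set Implicit Arguments.
Unset Strict Implicit.
Unset Printing Implicit Defensive.

Import Order.TTheory GRing.Theory Num.Theory.
Import numFieldNormedType.Exports.

Local Open Scope classical_set_scope.
Local Open Scope ring_scope.
Local Open Scope complex_scope.
Local Open Scope quotient_scope.

Definition torsion_pred (p : nat) (A : zmodType) : {pred A} :=
  fun x => x *+ p == 0.
Arguments torsion_pred : clear implicits.

Lemma torsion_zmod_closed p A : zmod_closed (torsion_pred p A).
Proof.
split=> [|x y]; rewrite !unfold_in ?mul0rn //.
by move=> /eqP x0 /eqP y0; rewrite mulrnBl x0 y0 subrr.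
Qed.

HB.instance Definition _ p A :=
  GRing.isZmodClosed.Build A (torsion_pred p A) (torsion_zmod_closed p A).

Section Torsion.
Variables (p : nat) (p_pr : prime p).

(* A[p]; the primality proof is an argument of the type because the scalar
   multiplication by 'F_p below is an action only for p prime. *)
Definition torsion (A : zmodType) :=
  let _ := p_pr in {x : A | x \in torsion_pred p A}.

Variable A : zmodType.

HB.instance Definition _ := [isSub of torsion A for @sval _ _].
HB.instance Definition _ := [Choice of torsion A by <:].
HB.instance Definition _ := [SubChoice_isSubZmodule of torsion A by <:].

Lemma torsionP (x : torsion A) : x *+ p = 0.
Proof. by apply/val_inj/eqP; rewrite raddfMn raddf0; exact: (valP x). Qed.

Lemma torsion_mulrn_mod (x : torsion A) n :
  x *+ (n %% (Zp_trunc (pdiv p)).+2) = x *+ n.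
Proof.
rewrite [X in (_ %% X)%N](Fp_cast p_pr) [in RHS](divn_eq n p) mulrnDr mulnC mulrnA.
by rewrite torsionP mul0rn add0r.
Qed.

Definition torsion_scale (a : 'F_p) (x : torsion A) : torsion A := x *+ a.

Lemma torsion_scaleA a b x :
  torsion_scale a (torsion_scale b x) = torsion_scale (a * b) x.
Proof.
by rewrite /torsion_scale -mulrnA mulnC; exact: esym (torsion_mulrn_mod _ _).
Qed.

Lemma torsion_scale1 : left_id 1 torsion_scale.
Proof. by move=> x; rewrite -[RHS](torsion_mulrn_mod x 1). Qed.

Lemma torsion_scaleDr : right_distributive torsion_scale +%R.
Proof. by move=> a x y; rewrite /torsion_scale mulrnDl. Qed.

Lemma torsion_scaleDl x : {morph torsion_scale^~ x : a b / a + b}.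
Proof.
by move=> a b; rewrite /torsion_scale -mulrnDr; exact: torsion_mulrn_mod.
Qed.

HB.instance Definition _ := GRing.Zmodule_isLmodule.Build 'F_p (torsion A)
  torsion_scaleA torsion_scale1 torsion_scaleDr torsion_scaleDl.

Lemma scale_torsionE (a : 'F_p) (x : torsion A) : a *: x = x *+ a.
Proof. by []. Qed.

End Torsion.

Section TorsionMap.
Variables (p : nat) (p_pr : prime p) (A B : zmodType) (f : {additive A -> B}).

Lemma torsion_map_subproof (x : torsion p_pr A) : f (val x) \in torsion_pred p B.
Proof.
rewrite unfold_in -raddfMn; apply/eqP; rewrite -[RHS](raddf0 f); congr (f _).
by apply/eqP; exact: (valP x).
Qed.

Definition torsion_map (x : torsion p_pr A) : torsion p_pr B :=
  Sub (f (val x)) (torsion_map_subproof x).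

End TorsionMap.

Section ComplexTori.
Variable R : realType.
Local Notation C := R[i].

Definition Zspan (w1 w2 : C) : {pred C} :=
  fun z => `[< exists m n : int, z = m%:~R * w1 + n%:~R * w2 >].

Lemma Zspan_zmod_closed w1 w2 : zmod_closed (Zspan w1 w2).
Proof.
split=> [|x y /asboolP[m [n ->]] /asboolP[m' [n' ->]]]; apply/asboolP.
  by exists 0, 0; rewrite !mul0r addr0.
by exists (m - m'), (n - n'); rewrite !intrB !mulrBl opprD addrACA.
Qed.

HB.instance Definition _ w1 w2 :=
  GRing.isZmodClosed.Build C (Zspan w1 w2) (Zspan_zmod_closed w1 w2).

Definition Rfree (w1 w2 : C) :=
  forall a b : R, a%:C * w1 + b%:C * w2 = 0 -> a = 0 /\ b = 0.

(* The field is typed [C -> bool] rather than [{pred C}] (whose universe is too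
   large for the record to have a choiceType structure). *)
Record lattice := Lattice {
  lattice_set : C -> bool;
  latticeP : exists w1 w2 : C, Rfree w1 w2 /\ lattice_set =1 Zspan w1 w2
}.

Definition lattice_pred (L : lattice) : {pred C} := lattice_set L.

Lemma lattice_zmod_closed (L : lattice) : zmod_closed (lattice_pred L).
Proof.
have [w1 [w2 [_ LE]]] := latticeP L.
have LE' : lattice_pred L =i Zspan w1 w2 by exact: LE.
by split=> [|x y]; rewrite !LE'; [exact: rpred0|exact: rpredB].
Qed.

HB.instance Definition _ (L : lattice) :=
  GRing.isZmodClosed.Build C (lattice_pred L) (lattice_zmod_closed L).

(* Elliptic curves over the complex numbers are taken in analytic form, as
   complex tori C/L; [ell L] is the underlying group, and the complex structure
   enters through [holomorphic]. *)
Definition ell (L : lattice) := Quotient.quot (lattice_pred L).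
HB.instance Definition _ L := EqQuotient.on (ell L).
HB.instance Definition _ L := GRing.Zmodule.on (ell L).

Definition ell_proj (L : lattice) (z : C) : ell L := \pi_(ell L) z.

(* The projection C -> C/L is a local biholomorphism, so a map between two such
   quotients is holomorphic iff it lifts locally to holomorphic functions.
   [derivable _ w 1] over the field C is complex differentiability at w. *)
Definition holomorphic (L L' : lattice) (f : ell L -> ell L') :=
  forall z : C, exists F : C^o -> C^o,
    \forall w \near (z : C^o),
      derivable F w 1 /\ ell_proj L' (F w) = f (ell_proj L w).

(* Isomorphisms are those of complex Lie groups: biholomorphic and additive. *)
Definition ell_iso (L L' : lattice) (f : {additive ell L -> ell L'}) :=
  holomorphic f /\
  exists g : ell L' -> ell L, [/\ cancel f g, cancel g f & holomorphic g].

End ComplexTori.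

Section Holomorphic.
Variable R : realType.
Implicit Types L : lattice R.

Lemma holomorphic_id L : holomorphic (@id (ell L)).
Proof.
move=> z; exists id.
apply: (@filterE _ _ (nbhs_filter (z : R[i]^o))) => w.
by split=> //; exact: derivable_id.
Qed.

Lemma holomorphic_comp L1 L2 L3 (f : ell L1 -> ell L2) (g : ell L2 -> ell L3) :
  holomorphic f -> holomorphic g -> holomorphic (g \o f).
Proof.
move=> hf hg z; have [F nF] := hf z; have [G nG] := hg (F z).
exists (G \o F).
have [dFz _] := nbhs_singleton nF.
have cF : {for z, continuous F}.
  exact/differentiable_continuous/derivable1_diffP.
have nGF := cF _ nG.
apply: filterS2 nF nGF => w [dF eF] [dG eG]; split.
  apply/derivable1_diffP.
  move/derivable1_diffP: dF => dF.
  move/derivable1_diffP: dG => dG.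
  exact: differentiable_comp dF dG.
exact: etrans eG (congr1 g eF).
Qed.

Lemma ell_iso_id L : ell_iso (idfun : {additive ell L -> ell L}).
Proof.
split; first exact: holomorphic_id.
by exists id; split=> //; exact: holomorphic_id.
Qed.

Lemma ell_iso_comp L1 L2 L3 (f : {additive ell L1 -> ell L2})
    (g : {additive ell L2 -> ell L3}) :
  ell_iso f -> ell_iso g -> ell_iso (g \o f : {additive ell L1 -> ell L3}).
Proof.
move=> [hf [f' [fK f'K hf']]] [hg [g' [gK g'K hg']]].
split; first exact: holomorphic_comp hf hg.
exists (f' \o g'); split; [exact: can_comp|exact: can_comp|].
exact: holomorphic_comp hg' hf'.
Qed.

Lemma ell_iso_inv L1 L2 (f : {additive ell L1 -> ell L2}) : ell_iso f ->
  exists g : {additive ell L2 -> ell L1}, [/\ ell_iso g, cancel f g & cancel g f].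
Proof.
move=> [hf [g [fK gK hg]]].
have ga : zmod_morphism g.
  by move=> x y; apply: (can_inj fK); rewrite raddfB !gK.
pose gM := GRing.isZmodMorphism.Build _ _ g ga.
pose G : {additive ell L2 -> ell L1} := HB.pack g gM.
by exists G; split=> //; split=> //; exists f.
Qed.

End Holomorphic.

Section Pairs.
Variables (R : realType) (p : nat) (p_pr : prime p) (eps : int).

Record ns_pair := NsPair {
  curve : lattice R;
  phi : torsion p_pr (ell curve) -> torsion p_pr (ell curve);
  phi_linear : linear phi;
  phi_sqr : forall x, phi (phi x) = eps%:~R *: x
}.

Arguments phi : clear implicits.

HB.instance Definition _ := gen_eqMixin ns_pair.
HB.instance Definition _ := gen_choiceMixin ns_pair.


Definition ns_pair_iso (X Y : ns_pair) : bool :=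
  `[< exists f : {additive ell (curve X) -> ell (curve Y)}, ell_iso f /\
        forall x, torsion_map f (phi X x) = phi Y (torsion_map f x) >].

Lemma ns_pair_iso_refl : reflexive ns_pair_iso.
Proof.
move=> X; apply/asboolP; exists idfun; split; first exact: ell_iso_id.
have tid (x : torsion p_pr (ell (curve X))) : torsion_map idfun x = x.
  exact: val_inj.
by move=> x; rewrite !tid.
Qed.

Lemma ns_pair_iso_sym : symmetric ns_pair_iso.
Proof.
suff sym X Y : ns_pair_iso X Y -> ns_pair_iso Y X.
  by move=> X Y; apply/idP/idP; exact: sym.
move=> /asboolP[f [fi fE]]; apply/asboolP.
have [g [gi fK gK]] := ell_iso_inv fi; exists g; split=> // y.
have tfK x : torsion_map g (torsion_map f x) = x :> torsion p_pr _.
  by apply: val_inj; exact: fK.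
have tgK x : torsion_map f (torsion_map g x) = x :> torsion p_pr _.
  by apply: val_inj; exact: gK.
by rewrite -{1}(tgK y) -fE tfK.
Qed.

Lemma ns_pair_iso_trans : transitive ns_pair_iso.
Proof.
move=> Y X Z /asboolP[f [fi fE]] /asboolP[g [gi gE]]; apply/asboolP.
exists (g \o f); split; first exact: ell_iso_comp.
have tc (x : torsion p_pr (ell (curve X))) :
  torsion_map (g \o f) x = torsion_map g (torsion_map f x).
  exact: val_inj.
by move=> x; rewrite !tc fE gE.
Qed.

Canonical ns_pair_equiv :=
  EquivRel ns_pair_iso ns_pair_iso_refl ns_pair_iso_sym ns_pair_iso_trans.
Canonical ns_pair_encModRel := defaultEncModRel ns_pair_iso.

Definition ns_pair_class := {eq_quot ns_pair_iso}.

Definition iso_class (X : ns_pair) : ns_pair_class := \pi_ns_pair_class X.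

End Pairs.

Arguments phi {R p p_pr eps}.
Arguments iso_class {R p p_pr eps}.

Definition mx22 (T : nmodType) (a b c d : T) : 'M[T]_2 :=
  \matrix_(i, j) nth 0 (nth [::] [:: [:: a; b]; [:: c; d]] i) j.

Section CartanCurve.
Variables (R : realType) (p : nat) (eps : int).
Local Notation C := R[i].

Definition upper_half := {z : C | 0 < complex.Im z}.

Definition mobius (g : 'M[int]_2) (z : C) : C :=
  ((g 0 0)%:~R * z + (g 0 1)%:~R) / ((g 1 0)%:~R * z + (g 1 1)%:~R).

Definition Gamma_ns : {pred 'M[int]_2} :=
  fun g => [&& \det g == 1, ((g 0 0)%R == (g 1 1)%R %[mod p])%Z
             & ((g 1 0)%R == (eps * g 0 1)%R %[mod p])%Z].

Definition ns_orbit_rel (t t' : upper_half) : bool :=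
  `[< exists2 g, g \in Gamma_ns & val t' = mobius g (val t) >].

Lemma det_mx22E (g : 'M[int]_2) : \det g = g 0 0 * g 1 1 - g 0 1 * g 1 0.
Proof. rewrite (expand_det_row _ 0) !big_ord_recl big_ord0 /cofactor !det_mx11 !mxE /=.
rewrite addr0 expr0 expr1 mul1r mulN1r mulrN.
by congr (g _ _ * g _ _ - g _ _ * g _ _); exact: val_inj. Qed.

Lemma Gamma_nsP (g : 'M[int]_2) :
  reflect [/\ g 0 0 * g 1 1 - g 0 1 * g 1 0 = 1,
              exists k, g 0 0 = g 1 1 + k * p%:Z
            & exists k, g 1 0 = eps * g 0 1 + k * p%:Z]
          (g \in Gamma_ns).
Proof.
rewrite unfold_in det_mx22E !eqz_mod_dvd.
apply: (iffP and3P) => [[/eqP dg /dvdzP[k kE] /dvdzP[l lE]]|[dg [k kE] [l lE]]].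
  split=> //; [exists k|exists l].
    by rewrite -kE addrC subrK.
  by rewrite -lE addrC subrK.
split; first exact/eqP.
  by apply/dvdzP; exists k; rewrite kE addrC addKr.
by apply/dvdzP; exists l; rewrite lE addrC addKr.
Qed.

Lemma mobius_den_neq0 (g : 'M[int]_2) (t : upper_half) :
  g \in Gamma_ns -> (g 1 0)%:~R * val t + (g 1 1)%:~R != 0 :> C.
Proof.
case/Gamma_nsP=> dg _ _; case: t => -[x y] /= y0.
have intC (m : int) : m%:~R = (m%:~R : R)%:C :> C by rewrite rmorph_int.
apply/eqP; rewrite !intC => /eqP; rewrite eq_complex /= => /andP[].
rewrite !mul0r !addr0 subr0 => h1 /eqP h2; move: h2 h1.
move=> /eqP; rewrite mulf_eq0 (gt_eqF y0) orbF intr_eq0 => /eqP c0.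
rewrite c0 mul0r add0r intr_eq0 => /eqP d0.
by move: dg; rewrite c0 d0 !mulr0 subr0.
Qed.

Lemma ns_orbit_rel_refl : reflexive ns_orbit_rel.
Proof.
move=> t; apply/asboolP; exists 1%:M.
  apply/Gamma_nsP; rewrite !mxE /=; split=> //; first by exists 0.
  by exists 0; rewrite mulr0 mul0r.
by rewrite /mobius !mxE /= mul1r mul0r addr0 add0r divr1.
Qed.

Lemma ns_orbit_rel_sym : symmetric ns_orbit_rel.
Proof.
suff sym t t' : ns_orbit_rel t t' -> ns_orbit_rel t' t.
  by move=> t t'; apply/idP/idP; exact: sym.
move=> /asboolP[g gG tE]; apply/asboolP.
have dn := mobius_den_neq0 t gG; have [dg [k kE] [l lE]] := Gamma_nsP _ gG.
exists (mx22 (g 1 1) (- g 0 1) (- g 1 0) (g 0 0)).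
  apply/Gamma_nsP; rewrite !mxE /=; split.
  - by rewrite -dg; ring.
  - by exists (- k); rewrite kE; ring.
  - by exists (- l); rewrite lE; ring.
have dgC : (g 0 0)%:~R * (g 1 1)%:~R = 1 + (g 0 1)%:~R * (g 1 0)%:~R :> C.
  by rewrite -!intrM -(intrD _ 1) -dg subrK.
rewrite /mobius !mxE /= tE /mobius !rmorphN /=.
move: dn dgC; set a := (g 0 0)%:~R; set b := (g 0 1)%:~R; set c := (g 1 0)%:~R.
set d := (g 1 1)%:~R; set z := val t => dn dgC.
have -> : d * ((a * z + b) / (c * z + d)) + - b = z / (c * z + d).
  apply: (mulIf dn); rewrite mulfVK // mulrDl -mulrA mulfVK //.
  by transitivity ((a * d) * z - b * c * z); [ring|rewrite dgC; ring].
have -> : - c * ((a * z + b) / (c * z + d)) + a = (c * z + d)^-1.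
  apply: (mulIf dn); rewrite mulVf // mulrDl -mulrA mulfVK //.
  by transitivity ((a * d) - b * c); [ring|rewrite dgC; ring].
by rewrite invrK mulfVK.
Qed.

Lemma ns_orbit_rel_trans : transitive ns_orbit_rel.
Proof.
move=> t2 t1 t3 /asboolP[g gG tE] /asboolP[h hG uE]; apply/asboolP.
have dng := mobius_den_neq0 t1 gG; have dnh := mobius_den_neq0 t2 hG.
have [dg [k kE] [l lE]] := Gamma_nsP _ gG.
have [dh [m mE] [n nE]] := Gamma_nsP _ hG.
have mulE i j : (h *m g) i j = h i 0 * g 0 j + h i 1 * g 1 j.
  rewrite mxE !big_ord_recl big_ord0 addr0.
  by congr (h i _ * g _ j + h i _ * g _ j); exact: val_inj.
exists (h *m g).
  apply/Gamma_nsP; split.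
  - by rewrite -det_mx22E det_mulmx !det_mx22E dg dh.
  - rewrite !mulE lE kE mE nE.
    by exists (h 1 1 * k + g 1 1 * m + m * k * p%:Z + h 0 1 * l - n * g 0 1); ring.
  - rewrite !mulE lE kE mE nE.
    by exists (eps * h 0 1 * k + n * g 1 1 + n * k * p%:Z + h 1 1 * l - eps * m * g 0 1);
       ring.
move: dng dnh; rewrite uE tE /mobius !mulE !rmorphD !rmorphM /=.
move: (h 0 0)%:~R (h 0 1)%:~R (h 1 0)%:~R (h 1 1)%:~R => a b c d.
move: (g 0 0)%:~R (g 0 1)%:~R (g 1 0)%:~R (g 1 1)%:~R (val t1) => a' b' c' d' z.
move=> n1 n2.
set w := (a' * z + b') / (c' * z + d').
have w1 : a' * z + b' = w * (c' * z + d') by rewrite mulfVK.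
have -> : (a * a' + b * c') * z + (a * b' + b * d') = (a * w + b) * (c' * z + d').
  by transitivity (a * (a' * z + b') + b * (c' * z + d')); [ring|rewrite w1; ring].
have -> : (c * a' + d * c') * z + (c * b' + d * d') = (c * w + d) * (c' * z + d').
  by transitivity (c * (a' * z + b') + d * (c' * z + d')); [ring|rewrite w1; ring].
by rewrite -mulf_div divff // mulr1.
Qed.

Canonical ns_orbit_equiv :=
  EquivRel ns_orbit_rel ns_orbit_rel_refl ns_orbit_rel_sym ns_orbit_rel_trans.
Canonical ns_orbit_encModRel := defaultEncModRel ns_orbit_rel.

Definition Y_ns := {eq_quot ns_orbit_rel}.

Definition ns_orbit (t : upper_half) : Y_ns := \pi_Y_ns t.

End CartanCurve.

Section TauPair.
Variables (R : realType) (p : nat) (p_pr : prime p).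
Local Notation C := R[i].

Lemma tau_free (t : upper_half R) : Rfree (val t) 1.
Proof.
case: t => -[x y] /= y0 a b; rewrite mulr1 => /eqP.
rewrite eq_complex /= !mul0r !addr0 subr0 => /andP[/eqP h1 /eqP h2].
have a0 : a = 0 by move/eqP: h2; rewrite mulf_eq0 (gt_eqF y0) orbF => /eqP.
by split=> //; move: h1; rewrite a0 mul0r add0r.
Qed.

Definition tau_lattice (t : upper_half R) : lattice R :=
  @Lattice R (Zspan (val t) 1)
    (ex_intro _ (val t) (ex_intro _ 1 (conj (@tau_free t) (frefl _)))).

Definition E_tau (t : upper_half R) := ell (tau_lattice t).

Variable t : upper_half R.
Let L := tau_lattice t.

Lemma ell_proj_eq0 (z : C) : ell_proj L z = 0 <->
  exists m n : int, z = m%:~R * val t + n%:~R * 1.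
Proof.
have E : (ell_proj L z == 0) = (z \in lattice_pred L).
  by rewrite -[z in RHS]subr0 Quotient.idealrBE /ell_proj raddf0.
by split=> [/eqP|h]; [|apply/eqP]; rewrite E; [move/asboolP|apply/asboolP].
Qed.

Lemma ell_proj_mulrn (z : C) n : ell_proj L z *+ n = ell_proj L (z *+ n).
Proof. by rewrite /ell_proj raddfMn. Qed.

Lemma p_neq0 : p%:R != 0 :> C.
Proof. by rewrite pnatr_eq0 -lt0n prime_gt0. Qed.

Lemma tau_basis_subproof (i : 'I_2) :
  ell_proj L (nth 0 [:: p%:R^-1; val t / p%:R] i) \in torsion_pred p (ell L).
Proof.
rewrite unfold_in ell_proj_mulrn; apply/eqP/ell_proj_eq0.
case: i => -[|[|//]] /= _.
  by exists 0, 1; rewrite -[LHS]mulr_natr mulVf ?p_neq0 // mul0r add0r mulr1.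
by exists 1, 0; rewrite -[LHS]mulr_natr mulfVK ?p_neq0 // mul0r addr0 mul1r.
Qed.

Definition tau_basis (i : 'I_2) : torsion p_pr (E_tau t) :=
  Sub (ell_proj L (nth 0 [:: p%:R^-1; val t / p%:R] i)) (tau_basis_subproof i).

Definition tau_comb (u : 'cV['F_p]_2) : torsion p_pr (E_tau t) :=
  \sum_i u i 0 *: tau_basis i.

Lemma tau_comb_linear : linear tau_comb.
Proof.
move=> a u v; rewrite /tau_comb scaler_sumr -big_split; apply: eq_bigr => i _.
by rewrite !mxE scalerDl scalerA.
Qed.

HB.instance Definition _ :=
  GRing.isLinear.Build 'F_p 'cV['F_p]_2 (torsion p_pr (E_tau t)) _ tau_comb
    tau_comb_linear.

Lemma tau_combE (m n : nat) (x : torsion p_pr (E_tau t)) :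
  x = m%:R *: tau_basis 0 + n%:R *: tau_basis 1 ->
  val x = ell_proj L ((m%:R + n%:R * val t) / p%:R).
Proof.
move=> ->; rewrite !scaler_nat raddfD !raddfMn /= !ell_proj_mulrn /ell_proj.
rewrite -raddfD /=; congr (\pi_(ell L) _).
by rewrite mulrDl -mulrA !mulr_natl.
Qed.

Lemma natr_FpK (a : 'F_p) : a = (a : nat)%:R.
Proof. by rewrite natr_Zp. Qed.

Lemma tau_comb_val u : val (tau_comb u) =
  ell_proj L (((u 0 0 : nat)%:R + (u 1 0 : nat)%:R * val t) / p%:R).
Proof.
apply: tau_combE; rewrite -!natr_FpK /tau_comb !big_ord_recl big_ord0 addr0.
by congr (_ *: _ + u _ _ *: tau_basis _); exact: val_inj.
Qed.

Lemma tau_comb_inj : injective tau_comb.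
Proof.
apply/raddf_inj => u u0.
have : ell_proj L (((u 0 0 : nat)%:R + (u 1 0 : nat)%:R * val t) / p%:R) = 0.
  by rewrite -tau_comb_val u0.
case/ell_proj_eq0 => m [n /(canRL (divfK p_neq0)) e].
have [e1 e0] : ((u 1 0 : nat)%:R - m%:~R * p%:R : R) = 0 /\
               ((u 0 0 : nat)%:R - n%:~R * p%:R : R) = 0.
  apply: (tau_free (t := t)).
  rewrite !rmorphB !rmorphM !rmorph_nat !rmorph_int.
  rewrite addrC -[RHS](subrr (((u 0 0 : nat)%:R + (u 1 0 : nat)%:R * val t) : C)).
  by rewrite [in X in _ = _ - X]e; ring.
have small (a : 'F_p) (k : int) : (a : nat)%:R - k%:~R * p%:R = 0 :> R -> a = 0.
  move/eqP; rewrite subr_eq0 -[p%:R]/((p%:Z)%:~R) -[(a : nat)%:R]/((a : nat)%:Z%:~R).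
  rewrite -intrM eqr_int => /eqP ak.
  have : (p%:Z %| (a : nat)%:Z)%Z by apply/dvdzP; exists k.
  rewrite -[(_ %| _)%Z]/(p %| a)%N => pa; apply: val_inj => /=.
  have ap : (a < p)%N by rewrite -[X in (_ < X)%N](Fp_cast p_pr) ltn_ord.
  by move: pa; rewrite /dvdn modn_small // => /eqP.
apply/matrixP => i j; rewrite mxE (ord1 j).
case: i => -[|[|//]] i2.
  by rewrite -(small _ _ e0); congr (u _ _); exact: val_inj.
by rewrite -(small _ _ e1); congr (u _ _); exact: val_inj.
Qed.

Lemma tau_comb_surj x : exists u, tau_comb u = x.
Proof.
have [z zE] : exists z, val x = ell_proj L z.
  by exists (repr (val x)); rewrite /ell_proj reprK.
have : ell_proj L (z *+ p) = 0.
  by rewrite -ell_proj_mulrn -zE; apply/eqP; exact: (valP x).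
case/ell_proj_eq0 => m [n]; rewrite mulr1 => e.
exists (\col_i (nth 0 [:: n%:~R; m%:~R] i)).
rewrite /tau_comb !big_ord_recl big_ord0 addr0 !mxE /= !scaler_int.
apply: val_inj; rewrite raddfD !raddfMz zE /= /ell_proj -!raddfMz -raddfD.
congr (\pi_(ell L) _); apply: (mulIf p_neq0); rewrite [RHS]mulr_natr e mulrDl.
rewrite -[_^-1 *~ n]mulrzl -[(_ / _) *~ m]mulrzl -!mulrA mulVf ?p_neq0 //.
by rewrite !mulr1 addrC.
Qed.

Definition tau_coord (x : torsion p_pr (E_tau t)) : 'cV['F_p]_2 :=
  odflt 0 [pick u | tau_comb u == x].

Lemma tau_coordK : cancel tau_coord tau_comb.
Proof.
move=> x; rewrite /tau_coord; case: pickP => [u /eqP //|/= none].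
by have [u ux] := tau_comb_surj x; have := none u; rewrite ux eqxx.
Qed.

Lemma tau_combK : cancel tau_comb tau_coord.
Proof. by move=> u; apply: tau_comb_inj; rewrite tau_coordK. Qed.

(* The endomorphism of E_tau[p] with matrix M, acting on columns, in the basis
   {1/p, tau/p}; see [tau_end_basis]. *)
Definition tau_end (M : 'M['F_p]_2) (x : torsion p_pr (E_tau t)) :
  torsion p_pr (E_tau t) := tau_comb (M *m tau_coord x).

Lemma tau_coord_linear : linear tau_coord.
Proof.
by move=> a x y; apply: tau_comb_inj; rewrite tau_comb_linear !tau_coordK.
Qed.

Lemma tau_end_linear M : linear (tau_end M).
Proof.
by move=> a x y; rewrite /tau_end tau_coord_linear mulmxDr -scalemxAr tau_comb_linear.
Qed.

Lemma tau_end_comp M N x : tau_end M (tau_end N x) = tau_end (M *m N) x.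
Proof. by rewrite /tau_end tau_combK mulmxA. Qed.

Lemma tau_end_scalar a x : tau_end a%:M x = a *: x.
Proof.
rewrite /tau_end mul_scalar_mx -[_ *: _]addr0 tau_comb_linear raddf0 addr0.
by rewrite tau_coordK.
Qed.

Lemma tau_end_basis M j : tau_end M (tau_basis j) = \sum_i M i j *: tau_basis i.
Proof.
have -> : tau_basis j = tau_comb (delta_mx j 0).
  rewrite /tau_comb (bigD1 j) //= mxE !eqxx scale1r big1 ?addr0 // => i /negPf ij.
  by rewrite mxE ij scale0r.
rewrite /tau_end tau_combK -colE /tau_comb; apply: eq_bigr => i _.
by rewrite mxE.
Qed.

Variable eps : int.

Definition phi_tau : torsion p_pr (E_tau t) -> torsion p_pr (E_tau t) :=
  tau_end (mx22 0 1 eps%:~R 0).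

Lemma phi_tau_linear : linear phi_tau.
Proof. exact: tau_end_linear. Qed.

Lemma phi_tau_sqr x : phi_tau (phi_tau x) = eps%:~R *: x.
Proof.
rewrite /phi_tau tau_end_comp -tau_end_scalar; congr tau_end.
apply/matrixP => i j; rewrite !mxE !big_ord_recl big_ord0 !mxE /=.
case: i => -[|[|//]] i2; case: j => -[|[|//]] j2 /=.
all: by rewrite ?mul0r ?mulr0 ?mul1r ?mulr1 ?addr0 ?add0r.
Qed.

Lemma phi_tau0 : phi_tau (tau_basis 0) = eps%:~R *: tau_basis 1.
Proof.
rewrite /phi_tau tau_end_basis !big_ord_recl big_ord0 !mxE /= scale0r add0r addr0.
by congr (_ *: tau_basis _); exact: val_inj.
Qed.

Lemma phi_tau1 : phi_tau (tau_basis 1) = tau_basis 0.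
Proof.
by rewrite /phi_tau tau_end_basis !big_ord_recl big_ord0 !mxE /= scale1r scale0r !addr0.
Qed.

Definition tau_pair : ns_pair R p_pr eps :=
  @NsPair R p p_pr eps (tau_lattice t) phi_tau phi_tau_linear phi_tau_sqr.

End TauPair.

(* Main.v *)
Require Import Defs.
From mathcomp Require Import all_boot all_order all_algebra.
From mathcomp Require Import all_classical all_reals all_analysis.
From HB Require Import structures.
From mathcomp Require Import complex ring.

(** A holomorphic additive map f : C/L -> C/L' is multiplication by a scalar:
    a local lift G of f at 0 with G 0 = 0 satisfies G w = 2 G (w / 2), because
    the difference is a small element of the discrete group L'; iterating,
    G w = 2^n G (w / 2^n) tends to G'(0) w, and f is determined by its values
    near 0.  Hence isomorphisms E_t' -> E_t are the multiplications by c t + d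
    with (c t + d) t' = a t + b and ad - bc = 1.  In the bases {1/p, tau/p} such
    an isomorphism has matrix N = (d b; c a), and it intertwines the matrices
    (0 1; eps 0) exactly when a = d and c = eps b mod p: this gives both
    well-definedness and injectivity.

    For surjectivity, let M be the matrix of phi on some E_t[p], so that
    M^2 = eps.  As eps is not a square, v |-> det(M v, v) is, up to a scalar, a
    form u^2 - eps s^2; by the pigeonhole principle this represents every
    element, so det(M v, v) = 1 for some v.  Then N = (M v, v) has
    determinant 1, satisfies N (0 1; eps 0) = M N, and lifts to SL_2(Z). *)

Set Implicit Arguments.
Unset Strict Implicit.
Unset Printing Implicit Defensive.
Import Order.TTheory GRing.Theory Num.Theory.
Import numFieldNormedType.Exports.
Local Open Scope classical_set_scope.
Local Open Scope ring_scope.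
Local Open Scope complex_scope.
Local Open Scope quotient_scope.

(** * Scaling maps between complex tori *)

Section EllProj.
Variable R : realType.
Local Notation C := R[i].
Implicit Types L : lattice R.

Lemma ell_projE L (z w : C) :
  (ell_proj L z == ell_proj L w) = (z - w \in lattice_pred L).
Proof. by rewrite Quotient.idealrBE. Qed.

Lemma ell_projD L : {morph ell_proj L : z w / z + w}.
Proof. by move=> z w; rewrite /ell_proj raddfD. Qed.

Lemma ell_projB L : {morph ell_proj L : z w / z - w}.
Proof. by move=> z w; rewrite /ell_proj raddfB. Qed.

Lemma ell_proj0 L : ell_proj L 0 = 0.
Proof. by rewrite /ell_proj raddf0. Qed.

Lemma ell_projMn L z n : ell_proj L (z *+ n) = ell_proj L z *+ n.
Proof. by rewrite /ell_proj raddfMn. Qed.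

Lemma ell_projMz L z n : ell_proj L (z *~ n) = ell_proj L z *~ n.
Proof. by rewrite /ell_proj raddfMz. Qed.

Lemma ell_proj_surj L (x : ell L) : exists z, x = ell_proj L z.
Proof. by exists (repr x); rewrite /ell_proj reprK. Qed.

Lemma scaling_holomorphic L L' (a : C) (f : ell L -> ell L') :
  (forall z, f (ell_proj L z) = ell_proj L' (a * z)) -> holomorphic f.
Proof.
move=> fE z; exists (fun w => a * w).
apply: (@filterE _ _ (nbhs_filter (z : C^o))) => w; split; last exact: esym.
by apply: (@derivableM _ _ (cst (a : C^o)) id) => //; exact: derivable_cst.
Qed.

Lemma scaling_map L L' (a : C) :
  (forall z, z \in lattice_pred L -> a * z \in lattice_pred L') ->
  exists f : {additive ell L -> ell L'},
    forall z, f (ell_proj L z) = ell_proj L' (a * z).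
Proof.
(* [g] uses the chosen representative [repr x]; by [aL] the value does not depend on that choice,
   which is [gE]. *)
move=> aL; pose g (x : ell L) : ell L' := ell_proj L' (a * repr x).
have gE z : g (ell_proj L z) = ell_proj L' (a * z).
  apply/eqP; rewrite ell_projE -mulrBr aL // -ell_projE.
  by rewrite /ell_proj reprK.
have ga : zmod_morphism g.
  move=> x y; have [z ->] := ell_proj_surj x; have [w ->] := ell_proj_surj y.
  by rewrite -ell_projB !gE mulrBr ell_projB.
pose gM := GRing.isZmodMorphism.Build _ _ g ga.
by exists (HB.pack_for {additive ell L -> ell L'} g gM).
Qed.

(** The equivalence says that [a] carries [L] onto [L'], so multiplication by [a^-1] also descends
    and gives the inverse. *)
Lemma scaling_iso L L' (a : C) : a != 0 ->
  (forall z, (z \in lattice_pred L) = (a * z \in lattice_pred L')) ->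
  exists f : {additive ell L -> ell L'},
    ell_iso f /\ forall z, f (ell_proj L z) = ell_proj L' (a * z).
Proof.
move=> a0 aL.
have [f fE] : exists f : {additive ell L -> ell L'},
    forall z, f (ell_proj L z) = ell_proj L' (a * z).
  by apply: scaling_map => z; rewrite -aL.
have [g gE] : exists g : {additive ell L' -> ell L},
    forall z, g (ell_proj L' z) = ell_proj L (a^-1 * z).
  by apply: scaling_map => z; rewrite aL mulVKf.
exists f; split=> //; split; first exact: scaling_holomorphic fE.
exists g; split; last exact: scaling_holomorphic gE.
- by move=> x; have [z ->] := ell_proj_surj x; rewrite fE gE mulKf.
- by move=> x; have [z ->] := ell_proj_surj x; rewrite gE fE mulVKf.
Qed.

End EllProj.

(** * Discreteness of lattices and normalisation of their bases *)

Section Lifting.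
Variable R : realType.
Local Notation C := R[i].

Lemma tau_latticeP (t : upper_half R) z :
  reflect (exists m n : int, z = m%:~R * val t + n%:~R)
          (z \in lattice_pred (tau_lattice t)).
Proof.
apply: (iffP (asboolP _)) => -[m [n ->]]; exists m, n; first by rewrite mulr1.
by rewrite mulr1.
Qed.

Lemma Re_Im_intr_comb (m n : int) (z : C) :
  (complex.Re (m%:~R * z + n%:~R) = m%:~R * complex.Re z + n%:~R) *
  (complex.Im (m%:~R * z + n%:~R) = m%:~R * complex.Im z).
Proof.
have intC (k : int) : k%:~R = (k%:~R : R)%:C :> C by rewrite rmorph_int.
by case: z => x y; rewrite !intC /= !mul0r !addr0 !subr0.
Qed.

(** The bound is the minimum of 1 and Im t: since Im (m t + n) = m Im t, a norm below Im t forces m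
    = 0, and then a norm below 1 forces n = 0. *)
Lemma tau_lattice_discrete (t : upper_half R) : exists2 d : C, 0 < d &
  forall z, z \in lattice_pred (tau_lattice t) -> `|z| < d -> z = 0.
Proof.
have y0 : 0 < complex.Im (val t) := valP t.
exists (Num.min 1 (complex.Im (val t)))%:C; first by rewrite ltcR lt_min ltr01.
move=> z /tau_latticeP[m [n ->]].
set w := _ + _ => wd.
have lew : `|complex.Re w| < 1 /\ `|complex.Im w| < complex.Im (val t).
  move: wd; rewrite normc_def ltcR lt_min => /andP[w1 w2]; split.
    apply: le_lt_trans w1; rewrite -sqrtr_sqr ler_wsqrtr // lerDl sqr_ge0 //.
  by apply: le_lt_trans w2; rewrite -sqrtr_sqr ler_wsqrtr // lerDr sqr_ge0.
case: lew; rewrite /w !Re_Im_intr_comb normrM (gtr0_norm y0) => h1.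
rewrite gtr_pMl // -intr_norm ltrz1 => h2.
have m0 : m = 0 by apply/eqP; rewrite -normr_le0 -ltzD1 add0r.
move: h1; rewrite m0 mul0r add0r -intr_norm ltrz1 => h1.
have -> : n = 0 by apply/eqP; rewrite -normr_le0 -ltzD1 add0r.
by rewrite mul0r addr0.
Qed.

(** Dividing by [w1] turns the basis into 1 and [s = w2 / w1], where [s] is not real because [w1]
    and [w2] are independent over the reals. *)
Lemma lattice_scaling (L : lattice R) : exists (t : upper_half R) (a : C),
  a != 0 /\
  forall z, (z \in lattice_pred L) = (a * z \in lattice_pred (tau_lattice t)).
Proof.
have [w1 [w2 [fr LE]]] := latticeP L.
have w10 : w1 != 0.
  apply/eqP => w10; have [] := fr 1 0; last by move/eqP; rewrite oner_eq0.
  by rewrite w10 mulr0 add0r mul0r.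
pose s := w2 / w1; have w2E : w2 = s * w1 by rewrite divfK.
have s0 : complex.Im s != 0.
  apply/eqP => s0; have [] := fr (- complex.Re s) 1; last first.
    by move=> _ /eqP; rewrite oner_eq0.
  rewrite w2E rmorph1 mul1r -mulrDl [X in _ + X]complexE s0 mulr0 addr0.
  by rewrite -rmorphD addNr mul0r.
(* [e] is the sign of Im s; replacing [s] by [-s] keeps the lattice and reaches the upper half
   plane. *)
have [e [t [eE tE]]] : exists (e : int) (t : upper_half R),
    e * e = 1 /\ val t = e%:~R * s.
  have [sp|sn|/eqP] := ltgtP (complex.Im s) 0; last by rewrite (negPf s0).
    have sp' : 0 < complex.Im (- s) by case: (s) sp => x y /=; rewrite oppr_gt0.
    exists (-1), (exist (fun z => is_true (0 < complex.Im z)) _ sp').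
    by split; rewrite // rmorphN mulN1r.
  exists 1, (exist (fun z => is_true (0 < complex.Im z)) _ sn).
  by split; rewrite // mul1r.
exists t, w1^-1; split; first by rewrite invr_eq0.
have eE' : e%:~R * e%:~R = 1 :> C by rewrite -intrM eE.
move=> z; rewrite [LHS](LE z); apply/asboolP/tau_latticeP => -[m [n zE]].
  exists (n * e), m; rewrite zE w2E tE intrM mulrDr addrC.
  by congr (_ + _); [rewrite -mulrA [e%:~R * _]mulrA eE' mul1r|]; field.
exists n, (m * e); rewrite w2E -[LHS](mulVKf w10) zE tE intrM; ring.
Qed.

End Lifting.

(** * Holomorphic homomorphisms of tori are scalings *)

Section Linearity.
Variable R : realType.
Local Notation C := R[i].

(** Norms are complex-valued here, so the Archimedean bound is applied to real parts; it suffices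
    because n < 2^n. *)
Lemma small_halving (x r : C) : 0 < r -> exists n, `|x / 2 ^+ n| < r.
Proof.
move=> r0; have rE : (complex.Re r)%:C = r by rewrite RRe_real ?gtr0_real.
have xE : (complex.Re `|x|)%:C = `|x| by rewrite RRe_real ?normr_real.
have s0 : 0 < complex.Re r by rewrite -ltcR rE.
pose y := complex.Re `|x| / complex.Re r.
have y0 : 0 <= y by apply: divr_ge0 (ltW s0); rewrite -ler0c xE.
exists (Num.bound y); rewrite normrM normfV normrX.
rewrite ltr_pdivrMr ?exprn_gt0 ?normr_gt0 ?pnatr_eq0 // normr_nat.
rewrite -rE -xE -(rmorph_nat (real_complex R)) -rmorphXn -rmorphM ltcR.
rewrite mulrC -ltr_pdivrMr //.
apply: lt_trans (archi_boundP y0) _.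
by rewrite -natrX ltr_nat ltn_expl.
Qed.

Lemma holomorphic_scaling (L : lattice R) (t : upper_half R)
    (f : {additive ell L -> ell (tau_lattice t)}) : holomorphic f ->
  exists a : C, forall z, f (ell_proj L z) = ell_proj (tau_lattice t) (a * z).
Proof.
set L' := tau_lattice t => /(_ 0) [F nF].
have [dF F0] := nbhs_singleton nF.
have [d d0 dL] := tau_lattice_discrete t.
(* A third, so that |G w| + 2 |G (w / 2)| stays below [d]. *)
have d3 : 0 < d / 3 by rewrite divr_gt0.
have cF : {for (0 : C^o), continuous F}.
  exact/differentiable_continuous/derivable1_diffP.
have /cvgrPdist_lt/(_ _ d3) nc := cF.
have [r /= r0 rP] := proj1 (nbhs_normP _ _)
  (@filterI _ _ (nbhs_filter (0 : C^o)) _ _ nF nc).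
pose G w := F w - F 0.
have rG w : `|w| < r -> ell_proj L' (G w) = f (ell_proj L w) /\ `|G w| < d / 3.
  move=> wr; have [] := rP w; first by rewrite /= sub0r normrN.
  case=> _ Fw Fd; split; last by rewrite distrC.
  by rewrite ell_projB Fw F0 ell_proj0 raddf0 subr0.
have rhalf w n : `|w| < r -> `|w / 2 ^+ n| < r.
  move=> wr; apply: le_lt_trans wr; rewrite normrM ler_piMr //.
  by rewrite normfV normrX normr_nat invf_le1 ?exprn_gt0 // exprn_ege1 // ler1n.
have Ghalf w : `|w| < r -> G w = G (w / 2) *+ 2.
  move=> wr; have [w1 w2] := rG _ wr; have := rG _ (rhalf w 1%N wr).
  rewrite expr1 => -[h1 h2].
  apply/eqP; rewrite -subr_eq0; apply/eqP; apply: dL.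
    rewrite -ell_projE w1 ell_projMn h1 -raddfMn -ell_projMn.
    by rewrite -[_ / _ *+ _]mulr_natr divfK.
  apply: le_lt_trans (ler_normB _ _) _; rewrite normrMn.
  have -> : d = d / 3 + (d / 3) *+ 2 by field.
  by rewrite ltrD // ltrMn2r.
have Giter w n : `|w| < r -> G w = G (w / 2 ^+ n) * 2 ^+ n.
  move=> wr; elim: n => [|n IH]; first by rewrite divr1 mulr1.
  rewrite IH (Ghalf _ (rhalf _ n wr)).
  have -> : w / 2 ^+ n.+1 = w / 2 ^+ n / 2 by rewrite exprSr invfM mulrA.
  by rewrite exprS mulrA [G _ * 2]mulr_natr.
have /cvgrPdist_lt dFlim := dF; move: dFlim; set a := lim _ => dFlim.
have Gw w : `|w| < r -> G w = a * w.
  move=> wr; have [->|w0] := eqVneq w 0; first by rewrite mulr0 /G subrr.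
  apply/eqP; apply: contraT => Gn.
  (* By [Giter] the difference quotient at [w / 2 ^+ n] equals [G w / w] for every n, so it stays at
     distance [|a - G w / w|] from its limit [a], the derivative of [F] at 0. *)
  have e0 : 0 < `|a - G w / w|.
    rewrite normr_gt0 subr_eq0; apply: contra Gn => /eqP ->.
    by rewrite divfK.
  have [s /= s0 sP] := proj1 (nbhs_normP _ _) (dFlim _ e0).
  have [n ns] := small_halving w s0.
  have h0 : w / 2 ^+ n != 0.
    by rewrite mulf_neq0 // invr_eq0 expf_neq0 // pnatr_eq0.
  have := sP (w / 2 ^+ n); rewrite /= sub0r normrN => /(_ ns h0).
  rewrite addr0 [_ *: 1]mulr1 -[F _ - F 0]/(G _) -[_ *: _]/(_ * _).
  by rewrite (Giter _ n wr) invf_div [_ * G _]mulrC mulrA ltxx.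
(* Additivity of [f] extends the formula beyond the disc: [z] is [2 ^ n] times a point of the
   disc. *)
exists a => z; have [n nz] := small_halving z r0.
have zE : z = (z / 2 ^+ n) *+ (2 ^ n)%N.
  by rewrite -mulr_natr natrX divfK // expf_neq0 // pnatr_eq0.
rewrite zE ell_projMn raddfMn -(rG _ nz).1 Gw // -ell_projMn.
by rewrite mulrnAr.
Qed.

End Linearity.

(** * Squares in finite fields and lifting to SL_2(Z) *)

Section FiniteFieldAndLifting.

(** Squaring has one preimage over 0 and at most two over any other square, so |F| is at most 1 + 2
    (|S| - 1). *)
Lemma card_squares (F : finFieldType) :
  (#|F| < #|[set x ^+ 2 | x : F]%SET| * 2)%N.
Proof.
set S := [set x ^+ 2 | x : F]%SET.
have S0 : 0 \in S by apply/imsetP; exists 0; rewrite ?expr0n.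
have -> : #|F| = (\sum_(y in S) #|[set x : F | x ^+ 2 == y]%SET|)%N.
  rewrite -sum1_card (partition_big (fun x : F => x ^+ 2) [in S]) /=; last first.
    by move=> x _; exact: imset_f.
  apply: eq_bigr => y _; rewrite -sum1_card.
  by apply: eq_bigl => x; rewrite inE.
rewrite (bigD1 0) //= (cardsD1 0 S) S0 mulnDl mul1n addSn ltnS.
have -> : [set x : F | x ^+ 2 == 0]%SET = [set 0]%SET.
  by apply/setP => x; rewrite !inE sqrf_eq0.
rewrite cards1 ltnS -sum_nat_const.
apply: (@leq_trans (\sum_(y in S | y != 0%R) 2)%N); last first.
  by apply: eq_leq; apply: eq_bigl => y; rewrite !inE andbC.
apply: leq_sum => y /andP[/imsetP[x _ ->] _].
apply: (@leq_trans #|[set x; - x]%SET|); last by rewrite cards2; case: eqP.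
by apply/subset_leq_card/fintype.subsetP => z; rewrite !inE eqf_sqr.
Qed.

(** [S] and its translate-dilate [T] have the same size, more than half of [F], so they meet; a
    common element is u^2 = c + e s^2. *)
Lemma binary_form_surj (F : finFieldType) (e c : F) : e != 0 ->
  exists u s, u ^+ 2 - e * s ^+ 2 = c.
Proof.
move=> e0; set S := [set x ^+ 2 | x : F]%SET.
pose T := [set c + e * y | y in S]%SET.
have cT : #|T| = #|S| by rewrite card_imset // => x y /addrI/(mulfI e0).
have : (S :&: T)%SET != finset.set0.
  rewrite -card_gt0 -(ltn_add2l #|S :|: T|%SET) addn0 cardsUI cT addnn -muln2.
  by apply: leq_ltn_trans (card_squares F); exact: max_card.
case/set0Pn => _ /setIP[/imsetP[u _ ->] /imsetP[_ /imsetP[s _ ->] us]].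
by exists u, s; rewrite us addrK.
Qed.

(** The left side is det(M v, v) for v = (s, t). With M = (x y; z w), y = 0 would give e = x^2;
    hence y is invertible, the trace vanishes, and y det(M v, v) = (x s + y t)^2 - e s^2. *)
Lemma nonsquare_mx_vector (F : finFieldType) (e : F) (M : 'M[F]_2) :
  (forall x, x ^+ 2 != e) -> M *m M = e%:M ->
  exists s t, (M 0 0 * s + M 0 1 * t) * t - s * (M 1 0 * s + M 1 1 * t) = 1.
Proof.
move=> ens MM.
have e0 : e != 0 by have := ens 0; rewrite expr0n eq_sym.
have MME i j : M i 0 * M 0 j + M i 1 * M 1 j = e *+ (i == j).
  have := congr1 (fun A : 'M[F]_2 => A i j) MM.
  rewrite !mxE !big_ord_recl big_ord0 addr0 => <-.
  by congr (M i _ * M _ j + M i _ * M _ j); exact: val_inj.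
have h00 := MME 0 0; have h01 := MME 0 1.
rewrite mulr1n in h00; rewrite mulr0n in h01.
move: h00 h01; set x := M 0 0; set y := M 0 1; set z := M 1 0; set w := M 1 1.
move=> h00 h01.
have y0 : y != 0.
  by apply/eqP => y0; have := ens x; rewrite -h00 y0 mul0r addr0 expr2 eqxx.
have wE : w = - x.
  by apply: (mulfI y0); apply/eqP; rewrite mulrN -addr_eq0 addrC [y * x]mulrC h01.
(* The form is made to take the value [y]; then [t] is solved from u = x s + y t. *)
have [u [s us]] := binary_form_surj y e0.
exists s, ((u - x * s) / y); rewrite wE; apply: (mulfI y0).
rewrite mulr1 -[RHS]us -h00; by field.
Qed.

Lemma Fp_intr_eq0 (p : nat) (p_pr : prime p) (k : int) :
  (k%:~R == 0 :> 'F_p) = (p %| k)%Z.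
Proof. by rewrite -(dvdz_pcharf (pchar_Fp p_pr)). Qed.

(** The standard representative of [y] is prime to p, so by the Chinese remainder theorem some m is
    [x] mod p and 1 mod [y]. *)
Lemma coprime_lift (p : nat) (p_pr : prime p) (x y : 'F_p) : y != 0 ->
  exists m n : int, [/\ m%:~R = x, n%:~R = y & coprimez m n].
Proof.
move=> y0.
have yE : (y : nat)%:Z%:~R = y := esym (natr_FpK y).
have cpy : coprime (y : nat) p.
  rewrite coprime_sym prime_coprime // -[(_ %| _)%N]/(p%:Z %| (y : nat)%:Z)%Z.
  by rewrite -Fp_intr_eq0 // [_%:~R]yE.
exists (chinese y p 1 x)%:Z, (y : nat)%:Z; split.
- rewrite [RHS]natr_FpK; apply: val_inj; rewrite /= !val_Fp_nat //.
  by rewrite chinese_modr.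
- exact/esym/natr_FpK.
- rewrite coprimezE !absz_nat.
  by rewrite -coprime_modl chinese_modl // coprime_modl coprime1n.
Qed.

(** The bottom row is lifted to a coprime pair and the top row arbitrarily; the determinant is then
    1 + k p, and a Bezout relation for the bottom row corrects it. *)
Lemma SL2_lift (p : nat) (p_pr : prime p) (A B C D : 'F_p) :
  A * D - B * C = 1 -> exists a b c d : int,
  [/\ a%:~R = A, b%:~R = B, c%:~R = C, d%:~R = D & a * d - b * c = 1].
Proof.
move=> det1.
have [c [d [cE dE cop]]] : exists c d : int,
    [/\ c%:~R = C, d%:~R = D & coprimez c d].
  (* [coprime_lift] needs a nonzero second entry; if D = 0 then C is nonzero and the roles are
     swapped. *)
  have [D0|D0] := eqVneq D 0; last exact: coprime_lift.
  have C0 : C != 0.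
    apply/eqP => C0; move/eqP: det1.
    by rewrite C0 D0 !mulr0 subr0 eq_sym oner_eq0.
  have [d [c [dE cE cop]]] := coprime_lift p_pr D C0.
  by exists c, d; rewrite coprimez_sym.
have [[u v] /= uv] := coprimezP _ _ cop.
pose a := (A : nat)%:Z; pose b := (B : nat)%:Z.
have aE : a%:~R = A := esym (natr_FpK A).
have bE : b%:~R = B := esym (natr_FpK B).
have : (p %| a * d - b * c - 1)%Z.
  rewrite -(Fp_intr_eq0 p_pr) !rmorphB !rmorphM /= aE bE cE dE.
  by rewrite det1 subrr.
case/dvdzP => k kE.
have p0 : p%:~R = 0 :> 'F_p by apply/eqP; rewrite Fp_intr_eq0.
(* As u c + v d = 1, this shift lowers the determinant by k p and is invisible mod p. *)
exists (a - k * p * v), (b + k * p * u), c, d; split=> //.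
- by rewrite rmorphB !rmorphM /= p0 mulr0 mul0r subr0.
- by rewrite rmorphD !rmorphM /= p0 mulr0 mul0r addr0.
transitivity (a * d - b * c - k * p * (u * c + v * d)); first by ring.
by rewrite uv mulr1 -kE opprB addrC subrK.
Qed.

End FiniteFieldAndLifting.

(** * Moebius transformations and their matrices on p-torsion *)

Section TorsionCoordinates.
Variables (R : realType) (p : nat) (p_pr : prime p).
Local Notation C := R[i].

Lemma mx22_mul_col (T : pzSemiRingType) (a b c d : T) (u : 'cV[T]_2) :
  ((mx22 a b c d *m u) 0 0 = a * u 0 0 + b * u 1 0) *
  ((mx22 a b c d *m u) 1 0 = c * u 0 0 + d * u 1 0).
Proof.
have uE (i : 'I_2) : (mx22 a b c d *m u) i 0 =
    mx22 a b c d i 0 * u 0 0 + mx22 a b c d i 1 * u 1 0.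
  rewrite mxE !big_ord_recl big_ord0 addr0.
  by congr (mx22 a b c d i _ * u _ _ + mx22 a b c d i _ * u _ _); exact: val_inj.
by rewrite !uE !mxE.
Qed.

Lemma mx2P (T : Type) (A B : 'M[T]_2) : A 0 0 = B 0 0 -> A 0 1 = B 0 1 ->
  A 1 0 = B 1 0 -> A 1 1 = B 1 1 -> A = B.
Proof.
move=> h00 h01 h10 h11; apply/matrixP => i j.
have I2 (k : 'I_2) : k = 0 \/ k = 1.
  by case: k => -[|[|//]] k2; [left|right]; exact: val_inj.
by case: (I2 i) => ->; case: (I2 j) => ->.
Qed.

Lemma mx2_mulE (T : pzSemiRingType) (A B : 'M[T]_2) i j :
  (A *m B) i j = A i 0 * B 0 j + A i 1 * B 1 j.
Proof.
rewrite mxE !big_ord_recl big_ord0 addr0.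
by congr (A i _ * B _ j + A i _ * B _ j); exact: val_inj.
Qed.

Lemma mx22_mulE (T : pzSemiRingType) (a b c d a' b' c' d' : T) :
  mx22 a b c d *m mx22 a' b' c' d' =
  mx22 (a * a' + b * c') (a * b' + b * d') (c * a' + d * c') (c * b' + d * d').
Proof. by apply: mx2P; rewrite mx2_mulE !mxE. Qed.

(** Arbitrary integer lifts of the coordinates are allowed, since matrix products yield unreduced
    ones. *)
Lemma tau_comb_intr (t : upper_half R) (u : 'cV['F_p]_2) (m n : int) :
  m%:~R = u 0 0 -> n%:~R = u 1 0 ->
  val (tau_comb p_pr t u) =
  ell_proj (tau_lattice t) ((m%:~R + n%:~R * val t) / p%:R).
Proof.
move=> mE nE.
have -> : tau_comb p_pr t u =
    tau_basis p_pr t 0 *~ m + tau_basis p_pr t 1 *~ n.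
  have scE (x : torsion p_pr (E_tau t)) (k : int) : x *~ k = (k%:~R : 'F_p) *: x.
    by rewrite scaler_int.
  rewrite !scE mE nE /tau_comb !big_ord_recl big_ord0 addr0.
  by congr (_ *: _ + u _ _ *: tau_basis _ _ _); exact: val_inj.
rewrite raddfD !raddfMz /= -!ell_projMz -ell_projD; congr (ell_proj _ _).
by rewrite mulrDl -mulrA !mulrzl.
Qed.

(** Multiplication by c t + d sends 1/p to (d + c t)/p and t'/p to (b + a t)/p, which are the
    columns of the matrix. *)
Lemma torsion_map_tau_comb (t t' : upper_half R) (a b c d : int)
    (f : {additive E_tau t' -> E_tau t}) :
  (forall z, f (ell_proj (tau_lattice t') z) =
     ell_proj (tau_lattice t) ((c%:~R * val t + d%:~R) * z)) ->
  (c%:~R * val t + d%:~R) * val t' = a%:~R * val t + b%:~R ->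
  forall u, torsion_map f (tau_comb p_pr t' u) =
    tau_comb p_pr t (mx22 d%:~R b%:~R c%:~R a%:~R *m u).
Proof.
move=> fE tE u; apply: val_inj; rewrite [LHS]/=.
pose m := (u 0 0 : nat)%:Z; pose n := (u 1 0 : nat)%:Z.
have mE : m%:~R = u 0 0 := esym (natr_FpK _).
have nE : n%:~R = u 1 0 := esym (natr_FpK _).
have -> := tau_comb_intr t' mE nE.
have -> := @tau_comb_intr t _ (d * m + b * n) (c * m + a * n).
- rewrite fE; congr (ell_proj _ _).
  rewrite mulrA mulrDr mulrCA tE; congr (_ / _).
  by rewrite !rmorphD !rmorphM /=; ring.
- by rewrite mx22_mul_col rmorphD !rmorphM /= mE nE.
- by rewrite mx22_mul_col rmorphD !rmorphM /= mE nE.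
Qed.

(** This is |c t + d|^2 Im z = det Im t, free of division. It gives both the positivity of Im z and
    the sign of a determinant. *)
Lemma Im_moebius (t : upper_half R) (z : C) (a b c d : int) :
  (c%:~R * val t + d%:~R) * z = a%:~R * val t + b%:~R ->
  ((c%:~R * complex.Re (val t) + d%:~R) ^+ 2 +
   (c%:~R * complex.Im (val t)) ^+ 2) * complex.Im z =
  (a * d - b * c)%:~R * complex.Im (val t).
Proof.
move=> zE; have h1 := congr1 (@complex.Re R) zE.
have h2 := congr1 (@complex.Im R) zE; move: h1 h2.
have ReM (x y : C) : (complex.Re (x * y) =
  complex.Re x * complex.Re y - complex.Im x * complex.Im y) *
  (complex.Im (x * y) =
  complex.Re x * complex.Im y + complex.Im x * complex.Re y).
  by case: x => ? ?; case: y.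
rewrite !ReM !Re_Im_intr_comb rmorphB !rmorphM /=.
move: (complex.Re _) (complex.Im _) (complex.Re z) (complex.Im z).
move=> x y x' y' h1 h2.
(* This is the imaginary part of the hypothesis multiplied by the conjugate of c t + d. *)
transitivity ((c%:~R * x + d%:~R) * ((c%:~R * x + d%:~R) * y' + c%:~R * y * x') -
  c%:~R * y * ((c%:~R * x + d%:~R) * x' - c%:~R * y * y')); first by ring.
by rewrite h1 h2; ring.
Qed.

Lemma moebius_iso (t t' : upper_half R) (a b c d : int) :
  a * d - b * c = 1 ->
  (c%:~R * val t + d%:~R) * val t' = a%:~R * val t + b%:~R ->
  exists f : {additive E_tau t' -> E_tau t}, ell_iso f /\
    forall u, torsion_map f (tau_comb p_pr t' u) =
      tau_comb p_pr t (mx22 d%:~R b%:~R c%:~R a%:~R *m u).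
Proof.
move=> det1 tE; set w := c%:~R * val t + d%:~R in tE.
have detC : a%:~R * d%:~R - b%:~R * c%:~R = 1 :> C.
  by rewrite -!intrM -intrB det1.
(* [E1] and [Et] write 1 and t as [w] times elements of the lattice of t', so [w] maps that lattice
   onto the one of t. *)
have E1 : w * (a%:~R - c%:~R * val t') = 1.
  rewrite mulrBr mulrCA tE /w -[RHS]detC; ring.
have Et : w * (d%:~R * val t' - b%:~R) = val t.
  rewrite mulrBr mulrCA tE /w.
  transitivity ((a%:~R * d%:~R - b%:~R * c%:~R) * val t); first by ring.
  by rewrite detC mul1r.
have w0 : w != 0.
  by apply/eqP => w0; move/eqP: E1; rewrite w0 mul0r eq_sym oner_eq0.
have [f [fi fE]] : exists f : {additive E_tau t' -> E_tau t},
    ell_iso f /\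
    forall z, f (ell_proj (tau_lattice t') z) = ell_proj (tau_lattice t) (w * z).
  apply: scaling_iso => // z; apply/tau_latticeP/tau_latticeP => -[m [n zE]].
    exists (m * a + n * c), (m * b + n * d).
    rewrite zE mulrDr mulrCA tE /w !rmorphD !rmorphM /=; ring.
  exists (m * d - n * c), (n * a - m * b); apply: (mulfI w0); rewrite zE.
  rewrite !rmorphB !rmorphM /=.
  transitivity (m%:~R * (w * (d%:~R * val t' - b%:~R)) +
                n%:~R * (w * (a%:~R - c%:~R * val t'))); last by rewrite /=; ring.
  by rewrite E1 Et mulr1.
by exists f; split=> //; exact: torsion_map_tau_comb.
Qed.

Lemma moebius_exists (t : upper_half R) (a b c d : int) :
  a * d - b * c = 1 -> exists t' : upper_half R,
  (c%:~R * val t + d%:~R) * val t' = a%:~R * val t + b%:~R.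
Proof.
move=> det1; have y0 : 0 < complex.Im (val t) := valP t.
have w0 : c%:~R * val t + d%:~R != 0.
  apply/eqP => w0.
  have := congr1 (@complex.Re R) w0; have := congr1 (@complex.Im R) w0.
  rewrite !Re_Im_intr_comb => /eqP; rewrite mulf_eq0 (gt_eqF y0) orbF intr_eq0.
  move=> /eqP c0; rewrite c0 mul0r add0r => /eqP; rewrite intr_eq0 => /eqP d0.
  by move/eqP: det1; rewrite c0 d0 !mulr0 subr0.
pose z := (a%:~R * val t + b%:~R) / (c%:~R * val t + d%:~R).
have zE : (c%:~R * val t + d%:~R) * z = a%:~R * val t + b%:~R.
  by rewrite mulrC divfK.
suff z0 : 0 < complex.Im z.
  by exists (exist (fun z => is_true (0 < complex.Im z)) z z0).
have := Im_moebius zE; rewrite det1 mul1r; set A := _ + _ => AE.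
have A0 : 0 <= A by rewrite addr_ge0 ?sqr_ge0.
move: y0; rewrite -AE; have [->|An] := eqVneq A 0; first by rewrite mul0r ltxx.
by rewrite pmulr_rgt0 // lt_def An.
Qed.

End TorsionCoordinates.

(** * Isomorphisms of pairs as matrix identities *)

Section TauPairs.
Variables (R : realType) (p : nat) (p_pr : prime p).
Local Notation C := R[i].

Lemma mulmx_cV_inj (T : pzSemiRingType) m n (A B : 'M[T]_(m, n)) :
  (forall u : 'cV[T]_n, A *m u = B *m u) -> A = B.
Proof.
move=> AB; apply/matrixP => i j.
by have /colP/(_ i) := AB (delta_mx j 0); rewrite -!colE !mxE.
Qed.

Lemma torsion_map_linear (A B : zmodType) (f : {additive A -> B}) :
  linear (torsion_map f : torsion p_pr A -> torsion p_pr B).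
Proof.
move=> a x y; apply: val_inj.
have valE (D : zmodType) (u v : torsion p_pr D) :
    val (a *: u + v) = val u *+ a + val v by rewrite raddfD raddfMn.
by rewrite [RHS]valE -[LHS]/(f (val _)) valE raddfD raddfMn.
Qed.

Lemma torsion_mapK (A B : zmodType) (f : {additive A -> B})
    (g : {additive B -> A}) : cancel f g ->
  cancel (torsion_map f : torsion p_pr A -> torsion p_pr B) (torsion_map g).
Proof. by move=> fK x; apply: val_inj; exact: fK. Qed.

Lemma tau_end_comb (t : upper_half R) (M : 'M['F_p]_2) u :
  tau_end M (tau_comb p_pr t u) = tau_comb p_pr t (M *m u).
Proof. by rewrite /tau_end tau_combK. Qed.

(** Compatibility with the endomorphisms becomes a matrix identity because [tau_comb] is bijective.
    One direction builds isomorphisms, the other extracts congruences. *)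
Lemma tau_end_intertwine (t t' : upper_half R) (N M M' : 'M['F_p]_2)
    (f : torsion p_pr (E_tau t') -> torsion p_pr (E_tau t)) :
  (forall u, f (tau_comb p_pr t' u) = tau_comb p_pr t (N *m u)) ->
  (forall x, f (tau_end M' x) = tau_end M (f x)) <-> N *m M' = M *m N.
Proof.
move=> fE; split=> [fM|NM x].
  apply: mulmx_cV_inj => u; apply: (@tau_comb_inj _ _ p_pr t).
  by rewrite -mulmxA -fE -tau_end_comb fM fE tau_end_comb mulmxA.
rewrite -(tau_coordK x) tau_end_comb !fE tau_end_comb.
by rewrite !mulmxA NM.
Qed.

Lemma ns_pair_tau_end (eps : int) (X : ns_pair R p_pr eps) :
  exists (t : upper_half R) (f : {additive ell (curve X) -> E_tau t})
         (M : 'M['F_p]_2),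
    [/\ ell_iso f, M *m M = eps%:~R%:M &
      forall x, torsion_map f (phi X x) = tau_end M (torsion_map f x)].
Proof.
have [t [a [a0 aL]]] := lattice_scaling (curve X).
have [f [fi _]] := scaling_iso a0 aL.
have [g [_ fK gK]] := ell_iso_inv fi.
(* [h] is [phi X] transported along [f] and read in coordinates; its values on the standard basis
   are the columns of [M]. *)
pose h u := tau_coord (torsion_map f (phi X (torsion_map g (tau_comb p_pr t u)))).
have hl : linear h.
  move=> b u v; rewrite /h tau_comb_linear torsion_map_linear.
  by rewrite phi_linear torsion_map_linear tau_coord_linear.
pose hM := GRing.isLinear.Build 'F_p 'cV['F_p]_2 'cV['F_p]_2 _ h hl.
pose H : {linear 'cV['F_p]_2 -> 'cV['F_p]_2} := HB.pack h hM.
pose M : 'M['F_p]_2 := \matrix_(i, j) h (delta_mx j 0) i 0.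
have hE u : h u = M *m u.
  rewrite [in LHS](matrix_sum_delta u) exchange_big big_ord1 /=.
  rewrite -[h _]/(H _) linear_sum; apply/colP => i; rewrite summxE mxE.
  by apply: eq_bigr => j _; rewrite linearZ !mxE mulrC.
have fM x : torsion_map f (phi X x) = tau_end M (torsion_map f x).
  by rewrite /tau_end -hE /h !tau_coordK torsion_mapK.
exists t, f, M; split=> //.
apply: mulmx_cV_inj => u; apply: (@tau_comb_inj _ _ p_pr t).
rewrite -mulmxA -!tau_end_comb -(torsion_mapK gK (tau_comb p_pr t u)) -!fM.
rewrite phi_sqr tau_end_scalar.
have f0 : torsion_map f 0 = 0 :> torsion p_pr (E_tau t).
  by apply: val_inj; exact: raddf0.
by rewrite -[X in torsion_map f X]addr0 torsion_map_linear f0 addr0.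
Qed.

Lemma tau_pair_surj (eps : int) (X : ns_pair R p_pr eps) :
  (forall x : int, ~~ (x * x == eps %[mod p])%Z) ->
  exists t, ns_pair_iso (tau_pair p_pr t eps) X.
Proof.
move=> ens; have [t [f [M [fi MM fM]]]] := ns_pair_tau_end X.
have ensF (x : 'F_p) : x ^+ 2 != eps%:~R.
  have xE : (x : nat)%:Z%:~R = x := esym (natr_FpK x).
  rewrite -subr_eq0 expr2 -xE -intrM -intrB Fp_intr_eq0 // -eqz_mod_dvd.
  exact: ens.
have [s [u su]] := nonsquare_mx_vector ensF MM.
(* With v = (s, u), the matrix N = (d b; c a) has columns M v and v mod p. *)
have [a [b [c [d [aE bE cE dE det1]]]]] : exists a b c d : int,
    [/\ a%:~R = u, b%:~R = s, c%:~R = M 1 0 * s + M 1 1 * u,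
        d%:~R = M 0 0 * s + M 0 1 * u & a * d - b * c = 1].
  by apply: (SL2_lift p_pr); rewrite -[RHS]su; ring.
have [t' tE] := moebius_exists t det1.
have [h [hi hE]] := moebius_iso p_pr det1 tE.
have Msqr x : tau_end M (tau_end M x) = eps%:~R *: x :> torsion p_pr (E_tau t).
  by rewrite tau_end_comp MM tau_end_scalar.
(* The intermediate pair (E_t, M): [f] identifies [X] with it, and [h] identifies the pair of t'
   with it. *)
pose Y : ns_pair R p_pr eps := NsPair (@tau_end_linear _ _ p_pr t M) Msqr.
exists t'; apply: (@ns_pair_iso_trans _ _ _ _ Y); last first.
  by rewrite ns_pair_iso_sym; apply/asboolP; exists f.
apply/asboolP; exists h; split=> //.
apply: (proj2 (tau_end_intertwine _ _ hE)).
have MME i j : M i 0 * M 0 j + M i 1 * M 1 j = eps%:~R *+ (i == j).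
  by rewrite -mx2_mulE MM mxE.
have m00 : M 0 0 * M 0 0 + M 0 1 * M 1 0 = eps%:~R := MME 0 0.
have m01 : M 0 0 * M 0 1 + M 0 1 * M 1 1 = 0 := MME 0 1.
have m10 : M 1 0 * M 0 0 + M 1 1 * M 1 0 = 0 := MME 1 0.
have m11 : M 1 0 * M 0 1 + M 1 1 * M 1 1 = eps%:~R := MME 1 1.
(* Both sides have columns eps v and M v, because M^2 = eps. *)
apply: mx2P; rewrite !mx2_mulE !mxE /= ?aE ?bE ?cE ?dE.
- transitivity (eps%:~R * s + 0 * u); first by ring.
  by rewrite -m00 -m01; ring.
- by ring.
- transitivity (0 * s + eps%:~R * u); first by ring.
  by rewrite -m11 -m10; ring.
- by ring.
Qed.

(** The congruences defining [Gamma_ns] say that (d b; c a) commutes with (0 1; eps 0) mod p. *)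
Lemma tau_pair_orbit (eps : int) (t t' : upper_half R) :
  ns_orbit_rel p eps t t' ->
  ns_pair_iso (tau_pair p_pr t' eps) (tau_pair p_pr t eps).
Proof.
move=> /asboolP[g gG tE]; have [dg [k kE] [l lE]] := Gamma_nsP _ _ _ gG.
have w0 := mobius_den_neq0 t gG.
have tE' : ((g 1 0)%:~R * val t + (g 1 1)%:~R) * val t' =
    (g 0 0)%:~R * val t + (g 0 1)%:~R.
  by rewrite tE /mobius mulrC divfK.
have [h [hi hE]] := moebius_iso p_pr dg tE'.
apply/asboolP; exists h; split=> //.
apply: (proj2 (tau_end_intertwine _ _ hE)).
have p0 : p%:~R = 0 :> 'F_p by apply/eqP; rewrite Fp_intr_eq0.
have aE : (g 0 0)%:~R = (g 1 1)%:~R :> 'F_p.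
  by rewrite kE rmorphD rmorphM /= p0 mulr0 addr0.
have cE : (g 1 0)%:~R = eps%:~R * (g 0 1)%:~R :> 'F_p.
  by rewrite lE rmorphD !rmorphM /= p0 mulr0 addr0.
by rewrite !mx22_mulE aE cE; congr mx22; ring.
Qed.

Lemma tau_pair_iso_orbit (eps : int) (t t' : upper_half R) :
  ns_pair_iso (tau_pair p_pr t' eps) (tau_pair p_pr t eps) ->
  ns_orbit_rel p eps t t'.
Proof.
move=> /asboolP[f [[fh [f' [fK f'K _]]] fM]].
have [w fE] := holomorphic_scaling fh.
(* Membership is an equivalence because [f] is injective. *)
have wL z : (z \in lattice_pred (tau_lattice t')) =
    (w * z \in lattice_pred (tau_lattice t)).
  rewrite -[z in LHS]subr0 -[w * z]subr0 -!ell_projE -fE !ell_proj0.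
  by rewrite -[X in _ = (_ == X)](raddf0 f) (can_eq fK).
have L1 (s : upper_half R) : 1 \in lattice_pred (tau_lattice s).
  by apply/tau_latticeP; exists 0, 1; rewrite mul0r add0r.
have Lt (s : upper_half R) : val s \in lattice_pred (tau_lattice s).
  by apply/tau_latticeP; exists 1, 0; rewrite mul1r addr0.
have intr_free (s : upper_half R) (m n : int) :
    m%:~R * val s + n%:~R = 0 -> m = 0 /\ n = 0.
  move=> mn; have := @tau_free _ s m%:~R n%:~R.
  rewrite !rmorph_int mulr1 => /(_ mn)[/eqP].
  by rewrite intr_eq0 => /eqP-> /eqP; rewrite intr_eq0 => /eqP->.
(* If [w] were 0, then 1/2 would lie in the lattice of t', making 1 even. *)
have w0 : w != 0.
  apply/eqP => w0.
  have : 2^-1 \in lattice_pred (tau_lattice t').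
    by rewrite wL w0 mul0r rpred0.
  case/tau_latticeP => m [n mn].
  have [] := intr_free t' (m * 2) (n * 2 - 1).
    rewrite rmorphB !rmorphM /= mulrAC addrA -mulrDl -mn mulVf ?subrr //.
  move=> _ /eqP; rewrite subr_eq0 => /eqP/(congr1 (fun z => odd `|z|%N)).
  by rewrite abszM oddM andbF.
have /tau_latticeP[c [d]] : w \in lattice_pred (tau_lattice t).
  by rewrite -[w]mulr1 -wL.
have /tau_latticeP[a [b]] : w * val t' \in lattice_pred (tau_lattice t).
  by rewrite -wL.
move=> tE wE.
(* The coordinates of [w^-1] and [w^-1 t] form the integer matrix (m n; k l), inverse to (a b; c
   d). *)
have /tau_latticeP[k [l klE]] : w^-1 \in lattice_pred (tau_lattice t').
  by rewrite wL mulfV.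
have /tau_latticeP[m [n mnE]] : w^-1 * val t \in lattice_pred (tau_lattice t').
  by rewrite wL mulVKf.
have [e1 e2] : k * a + l * c = 0 /\ k * b + l * d - 1 = 0.
  apply: (intr_free t); rewrite rmorphB !rmorphD !rmorphM /=.
  transitivity (k%:~R * (a%:~R * val t + b%:~R) +
    l%:~R * (c%:~R * val t + d%:~R) - 1).
    by rewrite /=; ring.
  by rewrite -tE -wE mulrCA [l%:~R * w]mulrC -mulrDr -klE mulfV ?subrr.
have [e3 e4] : m * a + n * c - 1 = 0 /\ m * b + n * d = 0.
  apply: (intr_free t); rewrite rmorphB !rmorphD !rmorphM /=.
  transitivity (m%:~R * (a%:~R * val t + b%:~R) +
    n%:~R * (c%:~R * val t + d%:~R) - val t).
    by rewrite /=; ring.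
  by rewrite -tE -wE mulrCA [n%:~R * w]mulrC -mulrDr -mnE mulVKf ?subrr.
have det_unit : (m * l - n * k) * (a * d - b * c) = 1.
  transitivity ((m * a + n * c - 1) * (k * b + l * d) + (k * b + l * d - 1) + 1 -
     (k * a + l * c) * (m * b + n * d)); first by ring.
  by rewrite e1 e2 e3 mul0r mul0r !add0r subr0.
(* The determinant is a unit of Z; it is positive since t and t' both have positive imaginary
   part. *)
have det_gt0 : 0 < a * d - b * c.
  have y0 : 0 < complex.Im (val t) := valP t.
  have y0' : 0 < complex.Im (val t') := valP t'.
  have := tE; rewrite wE => /Im_moebius; set A := _ + _ => AE.
  have A0 : 0 <= A by rewrite addr_ge0 ?sqr_ge0.
  have : 0 <= (a * d - b * c)%:~R * complex.Im (val t).
    by rewrite -AE mulr_ge0 // ltW.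
  rewrite pmulr_lge0 // ler0z le_eqVlt => /predU1P[z0|//].
  by move/eqP: det_unit; rewrite -z0 mulr0.
have det1 : a * d - b * c = 1.
  have /eqP := congr1 absz det_unit.
  by rewrite abszM muln_eq1 => /andP[_ /eqP D1]; rewrite -[LHS]gtz0_abs // D1.
have := tE; rewrite wE => tE'.
have hE := torsion_map_tau_comb p_pr _ tE'.
have {}hE : forall u, torsion_map f (tau_comb p_pr t' u) =
    tau_comb p_pr t (mx22 d%:~R b%:~R c%:~R a%:~R *m u).
  by apply: hE => z; rewrite fE wE.
have := proj1 (tau_end_intertwine _ _ hE) fM.
rewrite !mx22_mulE => NJ.
(* The first row of the commutation relation reads eps b = c and d = a mod p. *)
have := congr1 (fun A : 'M['F_p]_2 => A 0 0) NJ.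
have := congr1 (fun A : 'M['F_p]_2 => A 0 1) NJ.
rewrite !mxE /= !(mul0r, mulr0, mulr1, mul1r, addr0, add0r).
move=> da bc.
apply/asboolP; exists (mx22 a b c d); last first.
  transitivity ((a%:~R * val t + b%:~R) / (c%:~R * val t + d%:~R)).
    by rewrite -tE -wE mulrC mulKf.
  by rewrite /mobius !mxE.
rewrite unfold_in det_mx22E !mxE /= det1 eqxx /=.
rewrite !eqz_mod_dvd -!(Fp_intr_eq0 p_pr) !rmorphB !rmorphM /=.
by rewrite -da -bc mulrC !subrr eqxx.
Qed.

End TauPairs.

Theorem proposition1p1 (R : realType) (p : nat) (p_pr : prime p)
    (p_odd : odd p) (eps : int)
    (eps_nonsquare : forall x : int, ~~ (x * x == eps %[mod p])%Z) :
  exists F : Y_ns R p eps -> ns_pair_class R p_pr eps,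
    (forall tau : upper_half R,
        F (ns_orbit p eps tau) = iso_class (tau_pair p_pr tau eps)) /\
    bijective F.
Proof.
(* [F] is defined on a chosen representative; [FE] shows independence of the choice. *)
pose F (q : Y_ns R p eps) := iso_class (tau_pair p_pr (repr q) eps).
have FE tau : F (ns_orbit p eps tau) = iso_class (tau_pair p_pr tau eps).
  apply/eqP; rewrite eqmodE; apply: tau_pair_orbit.
  by rewrite -eqmodE reprK.
exists F; split=> //.
have orb (q : Y_ns R p eps) : exists tau, q = ns_orbit p eps tau.
  by exists (repr q); rewrite /ns_orbit reprK.
have Finj : injective F.
  move=> q q'; have [t ->] := orb q; have [t' ->] := orb q'.
  rewrite !FE => /eqP; rewrite eqmodE => /tau_pair_iso_orbit tt'.
  by apply/esym/eqP; rewrite eqmodE.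
have Fsurj X : exists q, F q = X.
  have [t tX] := tau_pair_surj (repr X) eps_nonsquare.
  exists (ns_orbit p eps t); rewrite FE -[RHS]reprK; apply/eqP.
  by rewrite eqmodE.
(* [bijective] asks for an inverse function, obtained by choosing preimages. *)
have [G GK] := choice Fsurj.
by exists G => // q; apply: Finj; rewrite GK.
Qed.
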